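(* For all integers $k \ge 5$ and $n \ge 2k$, $$rb(\mathcal{T}_n, kK_2) \le 2n+6k-16.$$
   Context: All graphs are undirected, finite and simple. $\mathcal{T}_n$ denotes the class of all plane triangulations of order $n$ (i.e. on $n$ vertices), where a plane triangulation is a plane graph all of whose faces, including the outer face, are bounded by triangles. $kK_2$ denotes a matching of size $k$ (i.e. $k$ pairwise vertex-disjoint edges). Edge-colorings are arbitrary (not necessarily proper), and an edge-coloring ''with $m$ colors'' is one in which exactly $m$ distinct colors appear on the edges. A subgraph of an edge-colored graph is rainbow if all of its edges have pairwise distinct colors. For a graph $H$, $rb(\mathcal{T}_n, H)$ denotes the minimum number $m$ of colors such that, for every $T_n \in \mathcal{T}_n$ containing $H$ as a subgraph, any edge-coloring of $T_n$ with at least $m$ colors contains a rainbow copy of $H$. *)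

(* Defs.v *)
From mathcomp Require Import all_boot all_fingroup.
From mathcomp Require Import boolp.

Set Implicit Arguments.
Unset Strict Implicit.
Unset Printing Implicit Defensive.

Record sgraph := SGraph {
  vertex :> finType;
  adj : rel vertex;
  adj_sym : symmetric adj;
  adj_irr : irreflexive adj }.

Definition edges (G : sgraph) : {set {set G}} :=
  [set [set p.1; p.2] | p : G * G & adj p.1 p.2].

(* kK_2: the i-th edge joins (i, false) and (i, true). *)
Definition matching_adj (k : nat) : rel ('I_k * bool) :=
  fun u v => (u.1 == v.1) && (u.2 != v.2).

Lemma matching_adj_sym k : symmetric (@matching_adj k).
Proof. by move=> u v; rewrite /matching_adj eq_sym [in X in _ && X]eq_sym. Qed.

Lemma matching_adj_irr k : irreflexive (@matching_adj k).
Proof. by move=> u; rewrite /matching_adj !eqxx. Qed.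

Definition matching (k : nat) : sgraph :=
  SGraph (@matching_adj_sym k) (@matching_adj_irr k).

(* A copy of H in G; it need not be induced. *)
Definition is_copy (H G : sgraph) (f : H -> G) : Prop :=
  injective f /\ (forall x y : H, adj x y -> adj (f x) (f y)).

Definition contains (G H : sgraph) : Prop := exists f : H -> G, is_copy f.

(* A coloring is a function on all sets of vertices of which only the values
   on [edges G] matter. *)
Definition ncolors (G : sgraph) (C : finType) (c : {set G} -> C) : nat :=
  #|c @: edges G|.

Definition has_rainbow_copy (G H : sgraph) (C : finType) (c : {set G} -> C) :=
  exists f : H -> G,
    is_copy f /\ {in edges H &, injective (fun e : {set H} => c (f @: e))}.

(* An edge xy yields the two darts (x, y) and (y, x); the tail of (x, y) is
   x. *)
Definition dart (G : sgraph) := {d : G * G | adj d.1 d.2}.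

Definition tail (G : sgraph) (d : dart G) : G := (val d).1.

Lemma dart_rev_subproof (G : sgraph) (d : dart G) :
  adj ((val d).2, (val d).1).1 ((val d).2, (val d).1).2.
Proof. by rewrite /= adj_sym (valP d). Qed.

Definition dart_rev (G : sgraph) (d : dart G) : dart G :=
  exist _ ((val d).2, (val d).1) (dart_rev_subproof d).

Lemma dart_rev_inj (G : sgraph) : injective (@dart_rev G).
Proof.
move=> d d' /(congr1 val) /= [e2 e1]; apply: val_inj.
by rewrite [LHS]surjective_pairing e1 e2 -surjective_pairing.
Qed.

(* The permutation that follows the boundary of the face on a fixed side of
   a dart: traverse (x, y), then leave y along the dart that follows (y, x)
   in the rotation at y. *)
Definition face_perm (G : sgraph) (s : {perm dart G}) : {perm dart G} :=
  (perm (@dart_rev_inj G) * s)%g.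

(* Plane graphs are represented by combinatorial maps: an embedding of a
   connected graph with at least one edge in an oriented closed surface is
   given, up to homeomorphism, by the cyclic order of the darts around each
   vertex ([rotationP]); its faces are the orbits of [face_perm], and the
   surface is the sphere iff its Euler characteristic is 2 ([eulerP]).
   Connectedness loses no generality for triangulations: in a disconnected
   plane graph some face has a disconnected boundary, which is not a
   triangle. *)
Record plane_graph := PlaneGraph {
  pgraph :> sgraph;
  rotation : {perm dart pgraph};
  rotationP : forall d d' : dart pgraph,
    (d' \in porbit rotation d) = (tail d == tail d');
  connectedP : forall x y : pgraph, connect (@adj pgraph) x y;
  eulerP : #|pgraph| + #|porbits (face_perm rotation)| = #|edges pgraph| + 2 }.

Definition faces (P : plane_graph) : {set {set dart P}} :=
  porbits (face_perm (rotation P)).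

(* In a simple graph a closed walk of length 3 is a triangle. The outer face
   is one of the orbits. *)
Definition triangulation (P : plane_graph) : Prop :=
  forall F : {set dart P}, F \in faces P -> #|F| = 3.

(* m colors force a rainbow copy of H in every plane triangulation of order n
   containing H. *)
Definition forces_rainbow (n : nat) (H : sgraph) (m : nat) : Prop :=
  forall P : plane_graph, triangulation P -> #|P| = n -> contains P H ->
  forall (C : finType) (c : {set P} -> C),
    m <= ncolors c -> has_rainbow_copy H c.

Lemma ex_forces_rainbow (n : nat) (H : sgraph) :
  exists m, `[< forces_rainbow n H m >].
Proof.
exists (n * n).+1; apply/asboolP => P _ Pn _ C c; rewrite ltnNge.
suff -> : ncolors c <= n * n by [].
apply: leq_trans (leq_imset_card _ _) _.
apply: leq_trans (leq_imset_card _ _) _.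
by apply: leq_trans (max_card _) _; rewrite card_prod Pn.
Qed.

Definition rb (n : nat) (H : sgraph) : nat := ex_minn (ex_forces_rainbow n H).

(* Main.v *)
Require Import Defs.
From mathcomp Require Import all_boot all_fingroup.
From mathcomp Require Import boolp zify.

Set Implicit Arguments.
Unset Strict Implicit.
Unset Printing Implicit Defensive.

(** Let [E] contain one edge of each colour, and suppose that a maximum matching
[M] of [E] has at most [k - 1] edges. Let [U] be the set of its endpoints; every
edge of [E] meets [U]. By planarity [U] spans at most [3|U| - 6 <= 6k - 12] edges.
A face has at most one side directed from [U] to its complement, so at most
[2n - 4] edges, the number of faces, leave [U]. Hence [|E| <= 2n + 6k - 16]. If
equality holds, both triangles at an edge [uv] of [M] have their apexes [x], [y]
outside [U], and all edges leaving [U] are in [E]; as [x <> y], replacing [uv] by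
[ux] and [vy] enlarges [M].

The bound on the edges spanned by [U] comes from Euler's formula for the map that
remains when all other edges are erased. Its faces are the atoms of the Boolean
algebra of unions of original faces that are not separated by an erased edge. *)

(** * Darts and the edges they carry *)

Section Darts.
Variable G : sgraph.
Implicit Types (d : dart G) (U : {set G}).

Definition head d : G := (val d).2.
Definition dart_edge d : {set G} := [set tail d; head d].

Lemma dart_eq d d' : tail d = tail d' -> head d = head d' -> d = d'.
Proof.
move=> t h; apply: val_inj.
by rewrite [LHS]surjective_pairing [RHS]surjective_pairing; congr pair.
Qed.

Lemma dart_adj d : adj (tail d) (head d).
Proof. exact: valP d. Qed.

Lemma adj_neq (x y : G) : adj x y -> x != y.
Proof. by apply: contraTneq => ->; rewrite adj_irr. Qed.

Lemma tail_rev d : tail (dart_rev d) = head d. Proof. by []. Qed.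
Lemma head_rev d : head (dart_rev d) = tail d. Proof. by []. Qed.

Lemma dart_revK : involutive (@dart_rev G).
Proof. by move=> d; apply: dart_eq. Qed.

Lemma dart_rev_neq d : dart_rev d != d.
Proof.
apply/negP => /eqP /(congr1 (@tail G)); rewrite tail_rev => e.
by have := adj_neq (dart_adj d); rewrite e eqxx.
Qed.

Lemma dart_of_adj (x y : G) : adj x y -> exists d, tail d = x /\ head d = y.
Proof. by move=> xy; exists (exist _ (x, y) xy). Qed.

Lemma edgesP (e : {set G}) : reflect (exists d, e = dart_edge d) (e \in edges G).
Proof.
apply: (iffP imsetP) => [[[x y]]|[d ->]].
  by rewrite inE /= => /dart_of_adj[d [<- <-]] ->; exists d.
by exists (val d) => //; rewrite inE dart_adj.
Qed.

Lemma dart_edge_rev d : dart_edge (dart_rev d) = dart_edge d.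
Proof. exact: setUC. Qed.

Lemma dart_edge_eq d d' :
  (dart_edge d == dart_edge d') = (d' \in [set d; dart_rev d]).
Proof.
apply/eqP/set2P => [e|[->|->]]; rewrite ?dart_edge_rev //.
have nd := adj_neq (dart_adj d); have nd' := adj_neq (dart_adj d').
have /set2P t : tail d' \in dart_edge d by rewrite e set21.
have /set2P h : head d' \in dart_edge d by rewrite e set22.
case: t h => [t|t] [h|h].
- by move: nd'; rewrite t h eqxx.
- by left; apply: dart_eq.
- by right; apply: dart_eq.
- by move: nd'; rewrite t h eqxx.
Qed.

Lemma card_edge (e : {set G}) : e \in edges G -> #|e| = 2.
Proof. by move=> /edgesP[d ->]; rewrite cards2 (adj_neq (dart_adj d)). Qed.

Lemma card_darts_over (S : {set {set G}}) : S \subset edges G ->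
  #|[set d | dart_edge d \in S]| = 2 * #|S|.
Proof.
move=> sS; pose A := [set d | dart_edge d \in S].
rewrite mulnC -sum_nat_const -[LHS]sum1_card.
rewrite (partition_big dart_edge (mem S)) => [|d]; last by rewrite inE.
apply: eq_bigr => e eS; have /edgesP[d ed] := subsetP sS _ eS.
rewrite (eq_bigl (mem [set d; dart_rev d])) => [|d'].
  by rewrite sum1_card cards2 eq_sym dart_rev_neq.
rewrite /= [LHS]andbC inE -dart_edge_eq eq_sym ed.
by case: eqP => //= <-; rewrite -ed.
Qed.

Definition edges_in U : {set {set G}} := [set e in edges G | e \subset U].

Lemma mem_edges_in U d :
  (dart_edge d \in edges_in U) = (tail d \in U) && (head d \in U).
Proof.
by rewrite inE subUset !sub1set (introT (edgesP _)) //; exists d.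
Qed.

End Darts.

(** * Unions of faces that survive the erasure of edges *)

Section Regions.
Variable P : plane_graph.
Local Notation s := (rotation P).
Local Notation phi := (face_perm (rotation P)).
Implicit Types (d : dart P) (X : {set dart P}) (U : {set P}) (D S : {set dart P}).

Lemma face_permE d : phi d = s (dart_rev d).
Proof. by rewrite permM permE. Qed.

Lemma tail_rotation d : tail (s d) = tail d.
Proof. by apply/esym/eqP; rewrite -rotationP; apply: (mem_porbit s 1 d). Qed.

Lemma tail_face_perm d : tail (phi d) = head d.
Proof. by rewrite face_permE tail_rotation. Qed.

(* Unions of faces that contain both darts or no dart of every edge with a dart
   in D: these are the unions of faces of the map with the edges of D erased. *)
Definition regions D : {set {set dart P}} :=
  [set X : {set dart P} | [forall d, (phi d \in X) == (d \in X)]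
     && [forall d in D, (dart_rev d \in X) == (d \in X)]].

Definition face_closed X := forall d, (phi d \in X) = (d \in X).

Lemma regionsP D X :
  reflect (face_closed X /\ {in D, forall d, (dart_rev d \in X) = (d \in X)})
          (X \in regions D).
Proof.
rewrite inE; apply: (iffP andP) => [[/forallP h1 /forall_inP h2]|[h1 h2]].
  by split=> [d|d dD]; apply/eqP; [apply: h1|apply: h2].
by split; [apply/forallP => d|apply/forall_inP => d dD]; apply/eqP; [apply: h1|apply: h2].
Qed.

(** Gluing along one more edge is a single parity condition. If some region [Y] separates [d] from
    its reverse, then symmetric difference with [Y] sends every region that does so injectively to
    one that does not. *)
Lemma card_regionsU1 D d : #|regions D| <= 2 * #|regions (d |: D)|.
Proof.
have sub : regions (d |: D) \subset regions D.
  apply/subsetP => X /regionsP[h1 h2]; apply/regionsP; split=> // d' d'D.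
  by apply: h2; rewrite inE d'D orbT.
rewrite -(cardsID (regions (d |: D)) (regions D)) (setIidPr sub) mul2n -addnn leq_add2l.
have [->|/set0Pn[Y]] := eqVneq (regions D :\: regions (d |: D)) set0.
  by rewrite cards0.
have split_d X : X \in regions D :\: regions (d |: D) ->
    X \in regions D /\ (dart_rev d \in X) = ~~ (d \in X).
  case/setDP => XD Xd; split=> //; apply/eqP; apply: contraNT Xd => Xd.
  move/regionsP: XD => [h1 h2]; apply/regionsP; split=> // d' /setU1P[->|]; last exact: h2.
  by case: (d \in X) Xd; case: (_ \in X).
move=> /split_d[/regionsP[Y1 Y2] Yd].
pose f X := [set d' | (d' \in X) (+) (d' \in Y)].
have f_inj : injective f.
  move=> X X' /setP e; apply/setP => d'; have := e d'; rewrite !inE.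
  by case: (d' \in Y); case: (d' \in X); case: (d' \in X').
rewrite -(card_imset _ f_inj); apply: subset_leq_card; apply/subsetP => Z.
case/imsetP => X /split_d[/regionsP[X1 X2] Xd] ->; apply/regionsP; split=> [d'|d'].
  by rewrite !inE X1 Y1.
case/setU1P => [->|d'D]; rewrite !inE.
  by rewrite Xd Yd; case: (d \in X); case: (d \in Y).
by rewrite X2 ?Y2.
Qed.

Lemma card_regionsU S D : #|regions D| <= 2 ^ #|S| * #|regions (S :|: D)|.
Proof.
move: {2}#|S| (leqnn #|S|) => m; elim: m S D => [|m IH] S D.
  by rewrite leqn0 cards_eq0 => /eqP->; rewrite cards0 mul1n set0U.
have [->|/set0Pn[d dS]] := eqVneq S set0; first by rewrite cards0 mul1n set0U.
rewrite (cardsD1 d) dS add1n ltnS => Sm.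
apply: leq_trans (card_regionsU1 D d) _; rewrite expnS -mulnA leq_mul2l /=.
by rewrite -{2}(setD1K dS) -setUA setUCA; apply: IH.
Qed.

(* The number of darts at x in X equals that of darts at x whose reverse is in X,
   because the rotation matches them up. *)
Lemma face_closed_vertex X d0 : face_closed X ->
  (forall d, tail d = tail d0 -> d != d0 -> (dart_rev d \in X) = (d \in X)) ->
  (dart_rev d0 \in X) = (d0 \in X).
Proof.
move=> Xphi Xd.
pose A := [set d | (tail d == tail d0) && (d \in X)].
pose B := [set d | (tail d == tail d0) && (dart_rev d \in X)].
have BE : B = s @^-1: A.
  apply/setP => d; rewrite !inE tail_rotation; congr (_ && _).
  by rewrite -Xphi face_permE dart_revK.
have : #|B| = #|A| by rewrite BE card_preimset //; apply: perm_inj.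
have eD1 : B :\ d0 = A :\ d0.
  apply/setP => d; rewrite !inE; case: eqVneq => //= dd0.
  by case: eqP => //= td; rewrite Xd.
rewrite (cardsD1 d0 B) (cardsD1 d0 A) eD1 => /eqP.
by rewrite eqn_add2r !inE eqxx /=; do 2!case: (_ \in X).
Qed.

(** The rotation is reversal followed by [phi], so [X] is stable under it and contains all or none
    of the darts at a vertex. Reversal then carries membership along edges, and the graph is
    connected. *)
Lemma face_closed_rev_closed X : face_closed X ->
  (forall d, (dart_rev d \in X) = (d \in X)) -> X != set0 -> X = setT.
Proof.
move=> Xphi Xrev /set0Pn[d0 d0X].
have Xs d : (s d \in X) = (d \in X) by rewrite -(dart_revK d) -face_permE Xphi !Xrev.
have Xtail d d' : d \in X -> tail d = tail d' -> d' \in X.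
  move=> dX /eqP; rewrite -rotationP => /porbitP[i ->].
  by elim: i => [|i IH]; rewrite ?expg0 ?perm1 // expgSr permM Xs.
have step d x : d \in X -> connect (@adj P) (tail d) x ->
    exists2 d', d' \in X & tail d' = x.
  move=> dX /connectP[p]; elim: p d dX => [|y p IH] d dX /= => [_ ->|]; first by exists d.
  case/andP => /dart_of_adj[d1 [t1 h1]] py ex.
  have d1X : dart_rev d1 \in X by rewrite Xrev (Xtail d).
  by apply: (IH _ d1X); rewrite tail_rev h1.
apply/setP => d; rewrite inE; have [d' d'X td'] := step _ _ d0X (connectedP (tail d0) (tail d)).
exact: Xtail d'X td'.
Qed.

(* A boundary dart has a further boundary edge at each end, by
   [face_closed_vertex]; simplicity of the graph makes the three edges distinct. *)
Lemma card_boundary X : face_closed X -> X != set0 -> X != setT ->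
  3 <= #|[set d in X | dart_rev d \notin X]|.
Proof.
move=> Xphi X0 XT; pose bd d := (dart_rev d \in X) != (d \in X).
have [d0 bd0] : exists d0, bd d0.
  apply/existsP; apply: contraR XT; rewrite negb_exists => /forallP Xrev.
  by rewrite (face_closed_rev_closed Xphi) // => d; apply/eqP/negPn/Xrev.
have other d : bd d -> exists d', [/\ bd d', tail d' = tail d & d' != d].
  move=> bdd; pose Q d' := [&& bd d', tail d' == tail d & d' != d].
  have [d' /and3P[? /eqP ? ?]|noQ] := pickP Q; first by exists d'.
  case/eqP: bdd; apply: face_closed_vertex => // d' td' nd'.
  by have := noQ d'; rewrite /Q td' eqxx nd' /= andbT => /negbFE /eqP.
have bd_rev d : bd (dart_rev d) = bd d by rewrite /bd dart_revK eq_sym.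
have [d1 [bd1 t1 n1]] := other _ bd0.
have [d2 [bd2 t2 n2]] : exists d', [/\ bd d', tail d' = head d0 & d' != dart_rev d0].
  by apply: (other (dart_rev d0)); rewrite bd_rev.
set B := [set d in X | _].
(* Of the two darts of a boundary edge exactly one lies in [X]; the count can therefore be made on
   edges, whichever dart represents them. *)
have bdB d : bd d -> dart_edge d \in @dart_edge P @: B.
  have [dX|dX] := boolP (d \in X); rewrite /bd ?(negbTE dX) ?dX => h.
    by apply: imset_f; rewrite inE dX /=; case: (_ \in X) h.
  rewrite -dart_edge_rev; apply: imset_f; rewrite inE dart_revK dX andbT.
  by case: (_ \in X) h.
have n0 := adj_neq (dart_adj d0).
apply: leq_trans (leq_imset_card (@dart_edge P) B).
apply: leq_trans (subset_leq_card (_ : [set dart_edge d0; dart_edge d1; dart_edge d2] \subset _)); last first.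
  by apply/subsetP => e /setUP[/set2P[]|/set1P] ->; apply: bdB.
rewrite setUC cardsU1 cards2 !inE negb_or ![dart_edge d2 == _]eq_sym !dart_edge_eq !inE.
have -> : d1 == dart_rev d0 = false.
  by apply: contraNF n0 => /eqP e; rewrite -t1 e tail_rev eqxx.
have -> : d2 == d0 = false.
  by apply: contraNF n0 => /eqP e; rewrite -t2 e eqxx.
have -> : d2 == d1 = false.
  by apply: contraNF n0 => /eqP e; rewrite -t1 -e t2 eqxx.
have -> : d2 == dart_rev d1 = false.
  apply: contraNF n1 => /eqP e; apply/eqP; apply: dart_eq => //.
  by rewrite -tail_rev -e t2.
by rewrite (negbTE n1) (negbTE n2).
Qed.

(** * Atoms of the algebra of regions *)

Definition regions_at D d := [set X in regions D | d \in X].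

Lemma in_regions_at D d X : (X \in regions_at D d) = (X \in regions D) && (d \in X).
Proof. by rewrite in_set. Qed.

(** Two darts share an atom when the same regions contain them. *)
Definition region_atoms D : {set {set dart P}} :=
  preim_partition (regions_at D) setT.

Lemma region_atoms_partition D : partition (region_atoms D) setT.
Proof. exact: preim_partitionP. Qed.

Lemma mem_region_atom D A X d d' :
  A \in region_atoms D -> X \in regions D -> d \in A -> d' \in A ->
  (d \in X) = (d' \in X).
Proof.
move=> /imsetP[d1 _ ->] XD /setIdP[_ /eqP/setP/(_ X)] + /setIdP[_ /eqP/setP/(_ X)].
by rewrite !in_regions_at XD /= => <- <-.
Qed.

(** No region tells [d] from [phi d], nor from its reverse when [d] is erased, so these lie in the
    same atom. *)
Lemma region_atoms_regions D A : A \in region_atoms D -> A \in regions D.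
Proof.
move=> /imsetP[d1 _ ->]; apply/regionsP; split=> [d|d dD];
  rewrite !inE; congr (_ == _); apply/setP => X;
  rewrite !in_regions_at; case: regionsP => //= -[h1 h2] //.
exact: h2.
Qed.

(** A region is the union of the atoms that it contains, hence is determined by them. *)
Lemma card_regions D : #|regions D| <= 2 ^ #|region_atoms D|.
Proof.
have /and3P[/eqP cov _ _] := region_atoms_partition D.
rewrite -card_powerset; pose f X := [set A in region_atoms D | A \subset X].
have f_cov X : X \in regions D -> cover (f X) = X.
  move=> XD; apply/setP => d; apply/bigcupP/idP => [[A]|dX].
    by rewrite inE => /andP[_ /subsetP]; apply.
  have : d \in cover (region_atoms D) by rewrite cov inE.
  case/bigcupP => A AD dA; exists A => //; rewrite inE AD; apply/subsetP => d' d'A.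
  by rewrite -(mem_region_atom AD XD dA d'A).
have f_inj : {in regions D &, injective f}.
  by move=> X Y XD YD e; rewrite -(f_cov X) // e f_cov.
rewrite -(card_in_imset f_inj); apply: subset_leq_card; apply/subsetP => _ /imsetP[X XD ->].
by rewrite inE; apply/subsetP => A; rewrite inE => /andP[].
Qed.

(** * Euler's inequality and the edge bound for the edges spanned by [U] *)

Definition darts_not_in U : {set dart P} := [set d | dart_edge d \notin edges_in U].

Lemma in_darts_not_in U d :
  (d \in darts_not_in U) = ~~ ((tail d \in U) && (head d \in U)).
Proof. by rewrite in_set mem_edges_in. Qed.

(** With nothing erased, each set of faces has a region as its union. *)
Lemma card_regions0 : 2 ^ #|faces P| <= #|regions set0|.
Proof.
rewrite -card_powerset; pose f (Q : {set {set dart P}}) := [set d | porbit phi d \in Q].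
have f_inj : {in powerset (faces P) &, injective f}.
  move=> Q Q'; rewrite !inE => /subsetP sQ /subsetP sQ' /setP e.
  apply/setP => F; apply/idP/idP => [FQ|FQ'].
    by have /imsetP[d _ dF] := sQ _ FQ; have := e d; rewrite !inE -dF FQ => <-.
  by have /imsetP[d _ dF] := sQ' _ FQ'; have := e d; rewrite !inE -dF FQ' => ->.
rewrite -(card_in_imset f_inj); apply: subset_leq_card; apply/subsetP => _ /imsetP[Q _ ->].
apply/regionsP; split=> [d|d]; last by rewrite inE.
rewrite !inE; congr (_ \in Q); apply/eqP; rewrite eq_porbit_mem.
exact: (mem_porbit phi 1 d).
Qed.

(** Deleting [v] erases the edges from [v] to [U], but only all except one of them impose a
    condition: the last edge is then the only one left at [v], and both its sides lie in the same
    regions. One factor 2 is thus saved, which pays for the vertex [v]. *)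
Lemma regions_insert U v d0 : v \notin U -> tail d0 = v -> head d0 \in U ->
  2 ^ #|edges_in U|.+1 * #|regions (darts_not_in (v |: U))|
    <= 2 ^ #|edges_in (v |: U)| * #|regions (darts_not_in U)|.
Proof.
move=> vU t0 h0; pose S := [set d : dart P | (tail d == v) && (head d \in U)].
have eS : #|edges_in U| + #|S| <= #|edges_in (v |: U)|.
  have S_inj : {in S &, injective (@dart_edge P)}.
    move=> d d'; rewrite !inE => /andP[/eqP t h] /andP[/eqP t' h'] /eqP.
    rewrite dart_edge_eq !inE => /orP[/eqP // | /eqP e].
    by move: vU; rewrite -t' e tail_rev h.
  rewrite -(card_in_imset S_inj) -cardsUI.
  rewrite [X in _ + X](_ : _ = 0) ?addn0; last first.
    apply/eqP; rewrite cards_eq0; apply/eqP/setP => e; rewrite !inE.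
    apply/negP => /andP[/andP[_ /subsetP eU] /imsetP[d]].
    rewrite !inE => /andP[/eqP t _] ee; move: vU; rewrite eU // ee -t set21 //.
  apply: subset_leq_card; apply/subsetP => e /setUP[|/imsetP[d]].
    by rewrite !inE => /andP[-> /= eU]; apply: subset_trans eU (subsetU1 _ _).
  by rewrite inE => /andP[/eqP t h] ->; rewrite mem_edges_in !inE t eqxx h orbT.
have d0S : d0 \in S by rewrite inE t0 eqxx h0.

(* The condition at [d0] is not imposed on the left; [face_closed_vertex] derives it from the other
   darts at [v]. *)
have sub : regions ((S :\ d0) :|: darts_not_in (v |: U)) \subset regions (darts_not_in U).
  apply/subsetP => X /regionsP[Xphi Xrev]; apply/regionsP; split=> //.
  have Xv d : tail d = v -> d != d0 -> (dart_rev d \in X) = (d \in X).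
    move=> td dd0; apply: Xrev; have := adj_neq (dart_adj d).
    rewrite in_setU in_setD1 in_set in_darts_not_in td dd0 eqxx !in_setU1 eqxx /=.
    by rewrite eq_sym => /negbTE->; case: (head d \in U).
  have Xv' d : tail d = v -> (dart_rev d \in X) = (d \in X).
    have [-> _|dd0 td] := eqVneq d d0; last exact: Xv.
    by apply: face_closed_vertex => // d'; rewrite t0; apply: Xv.
  move=> d; rewrite in_darts_not_in => dU; have [td|tv] := eqVneq (tail d) v; first exact: Xv'.
  have [hd|hv] := eqVneq (head d) v.
    by rewrite -(Xv' (dart_rev d)) ?dart_revK.
  apply: Xrev; rewrite in_setU in_darts_not_in !in_setU1 (negbTE tv) (negbTE hv) /=.
  by rewrite dU orbT.
have := card_regionsU (S :\ d0) (darts_not_in (v |: U)).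
have := subset_leq_card sub; set n1 := #|regions _|; set n2 := #|regions _|.
set n3 := #|regions _| => le12 le31; apply: leq_trans (leq_mul (leqnn _) le31) _.
rewrite mulnA -expnD; apply: leq_mul le12; rewrite leq_exp2l //.
by move: eS; rewrite (cardsD1 d0 S) d0S addSnnS.
Qed.

Lemma exists_adj_notin U : U != set0 -> U != setT ->
  exists d, tail d \notin U /\ head d \in U.
Proof.
move=> /set0Pn[u uU]; rewrite -subTset => /subsetPn[v _ vU].
have /connectP[p] := connectedP u v; elim: p u uU => [|y p IH] u uU /= => [_ e|].
  by rewrite e uU in vU.
case/andP => /dart_of_adj[d [td hd]] py ev; have [yU|yU] := boolP (y \in U); first exact: IH yU py ev.
by exists (dart_rev d); rewrite tail_rev head_rev td hd.
Qed.

(* Starting from all vertices, where this is [eulerP], delete one at a time a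
   vertex with a neighbour in the remaining set. *)
Lemma euler_edges_in U : U != set0 ->
  #|edges_in U| + 2 <= #|U| + #|region_atoms (darts_not_in U)|.
Proof.
(* Passing to powers of 2 lets the induction run on numbers of regions, which change by controlled
   factors; [card_regions] returns to atoms. *)
move=> U0; rewrite -(leq_exp2l _ _ (ltnSn 1)) expnD.
suff: 2 ^ (#|edges_in U| + 2) <= 2 ^ #|U| * #|regions (darts_not_in U)|.
  rewrite !expnD => /leq_trans; apply; rewrite leq_mul2l card_regions orbT //.
move: {2}#|~: U| (leqnn #|~: U|) => m; elim: m U U0 => [|m IH] U U0.
  rewrite leqn0 cards_eq0 -(inj_eq (@setC_inj _)) setCK setC0 => /eqP->.
  have -> : edges_in [set: P] = edges P by apply/setP => e; rewrite inE subsetT andbT.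
  have -> : darts_not_in [set: P] = set0.
    by apply/setP => d; rewrite in_darts_not_in !inE.
  by rewrite -eulerP cardsT expnD leq_mul2l card_regions0 orbT.
have [UT|UT] := eqVneq U setT; first by move=> _; apply: IH; rewrite // UT setCT cards0.
have [d [td hd]] := exists_adj_notin U0 UT; set v := tail d in td.
rewrite (cardsD1 v) inE td add1n ltnS => Um.
have vU0 : v |: U != set0 by apply/set0Pn; exists v; rewrite setU11.
have := IH (v |: U) vU0; rewrite setCU setIC -setDE => /(_ Um).
have := regions_insert td erefl hd; rewrite cardsU1 td /= !expnD expnS.
have : 0 < 2 ^ #|edges_in (v |: U)| by rewrite expn_gt0.
move: (2 ^ #|edges_in (v |: U)|) (2 ^ #|edges_in U|) (2 ^ #|U|) => c a u.
move: #|regions _| #|regions _| => e b c0 le1 le2.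
(* [b] is the number of regions for [v |: U] and [e] that for [U]; the two inequalities are chained
   after multiplying the goal by [b]. *)
have b0 : 0 < b by rewrite lt0n; apply: contraTneq le2 => ->; rewrite muln0; lia.
rewrite -(leq_pmul2r b0) -[u * e * b]mulnAC.
apply: (@leq_trans (2 * (c * e))); first by lia.
by rewrite mulnA leq_mul2r; lia.
Qed.

(** Each atom has at least three boundary darts, all on edges spanned by [U] because atoms cannot
    end at an erased edge. Double counting bounds three times the number of atoms by twice the
    number of edges, and Euler's inequality finishes. *)
Lemma card_edges_in_le U : 2 < #|U| -> #|edges_in U| + 6 <= 3 * #|U|.
Proof.
move=> U3; have U0 : U != set0 by rewrite -card_gt0; lia.
have := euler_edges_in U0; set D := darts_not_in U.
(* A single atom has no boundary; then Euler's inequality alone leaves at most [#|U| - 1] edges,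
   which suffices for [2 < #|U|]. *)
have [|f1] := leqP #|region_atoms D| 1; first by lia.
suff : #|region_atoms D| * 3 <= 2 * #|edges_in U| by lia.
have sE : edges_in U \subset edges P by apply/subsetP => e /setIdP[].
rewrite -(card_darts_over sE) -[leqRHS]sum1_card big_mkcond.
rewrite (eq_bigl [in [set: dart P]]) => [|d]; last by rewrite !inE.
rewrite (set_partition_big _ (region_atoms_partition D)) -sum_nat_const.
apply: leq_sum => A AD; have /regionsP[Aphi Arev] := region_atoms_regions AD.
have A0 : A != set0.
  have /and3P[_ _ n0] := region_atoms_partition D.
  by apply: contraNneq n0 => <-.
have AT : A != setT.
  apply/eqP => AT; move: f1; rewrite (cardsD1 A) AD (_ : _ :\ A = set0) ?cards0 //.
  have /and3P[_ /trivIsetP tr n0] := region_atoms_partition D.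
  apply/setP => B; rewrite !inE; apply/negP => /andP[BA BD].
  have := tr _ _ BD AD BA; rewrite AT -setI_eq0 setIT => /eqP B0.
  by rewrite -B0 BD in n0.
apply: leq_trans (card_boundary Aphi A0 AT) _.
rewrite -big_mkcondr sum1_card; apply: subset_leq_card; apply/subsetP => d.
move=> /setIdP[dA rdA]; rewrite unfold_in /= dA /= inE.
apply/negPn/negP => dD; move: rdA; rewrite Arev ?dA // inE.
by rewrite /edges_in.
Qed.

End Regions.

(** * Triangular faces and the edges leaving a vertex set *)

Section Triangulations.
Variable P : plane_graph.
Hypothesis tri : triangulation P.
Local Notation phi := (face_perm (rotation P)).
Implicit Types (d : dart P) (U : {set P}).

Lemma card_face d : #|porbit phi d| = 3.
Proof. by apply: tri; apply: imset_f. Qed.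

Lemma face_perm3 d : phi (phi (phi d)) = d.
Proof. by have := iter_porbit phi d; rewrite card_face. Qed.

Lemma porbit_face d d' : 
  reflect [\/ d' = d, d' = phi d | d' = phi (phi d)] (d' \in porbit phi d).
Proof.
apply: (iffP idP) => [/porbitP[i ->]|[]->]; last 3 first.
- exact: porbit_id.
- exact: (mem_porbit phi 1).
- by rewrite -[phi (phi d)]permM; apply: (mem_porbit phi 2).
elim: i => [|i]; first by rewrite expg0 perm1; constructor 1.
have -> : (phi ^+ i.+1)%g d = phi ((phi ^+ i)%g d) by rewrite expgSr permE.
case=> ->; rewrite ?face_perm3; by [constructor 1|constructor 2|constructor 3].
Qed.

Lemma card_darts_faces : #|{: dart P}| = 3 * #|faces P|.
Proof.
rewrite -[LHS]sum1_card (partition_big (porbit phi) [in faces P]) => [|d _]; last exact: imset_f.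
rewrite mulnC -sum_nat_const; apply: eq_bigr => F FP.
rewrite sum1_card -(tri FP); apply: eq_card => d; rewrite unfold_in /=.
have /imsetP[d0 _ ->] := FP; exact: eq_porbit_mem.
Qed.

Lemma card_faces : #|faces P| + 4 = 2 * #|P|.
Proof.
have := card_darts_over (subxx (edges P)).
rewrite (_ : [set d | _] = setT); last first.
  by apply/setP => d; rewrite !inE; apply/edgesP; exists d.
rewrite cardsT card_darts_faces.
have : #|P| + #|faces P| = #|edges P| + 2 by apply: eulerP.
lia.
Qed.

(** Each edge between [U] and its complement has exactly one such dart, so this set counts those
    edges. *)
Definition descending U : {set dart P} := [set d : dart P | (tail d \in U) && (head d \notin U)].

Lemma descendingP U d : reflect (tail d \in U /\ head d \notin U) (d \in descending U).
Proof. by rewrite inE; apply: andP. Qed.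

(** On a triangle, the dart after a descending one starts outside [U] and the dart before it ends in
    [U]. *)
Lemma porbit_descending_inj U : {in descending U &, injective (porbit phi)}.
Proof.
move=> d d' /descendingP[t h] /descendingP[t' h'] e.
have : d' \in porbit phi d by rewrite -eq_porbit_mem e.
case/porbit_face => // ed'; move: t' h'; rewrite ed'.
  by rewrite tail_face_perm (negbTE h).
by rewrite -tail_face_perm face_perm3 t.
Qed.

Lemma card_descending_le U : #|descending U| <= #|faces P|.
Proof.
rewrite -(card_in_imset (@porbit_descending_inj U)); apply: subset_leq_card.
by apply/subsetP => _ /imsetP[d _ ->]; apply: imset_f.
Qed.

(** When the bound is attained every face has a descending dart. On the face of [d] it is neither
    [d] nor [phi (phi d)], as both end in [U]. *)
Lemma apex_descending U d : #|faces P| <= #|descending U| ->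
  tail d \in U -> head d \in U -> phi d \in descending U.
Proof.
move=> le t h.
have : porbit phi @: descending U = faces P.
  apply/eqP; rewrite eqEcard (card_in_imset (@porbit_descending_inj U)) le andbT.
  by apply/subsetP => _ /imsetP[d' _ ->]; apply: imset_f.
move/setP/(_ (porbit phi d)); rewrite [RHS]imset_f // => /imsetP[d' d'U e].
have : d' \in porbit phi d by rewrite e porbit_id.
case/porbit_face => ed'; rewrite ed' // in d'U.
  by case/descendingP: d'U; rewrite h.
by case/descendingP: d'U; rewrite -tail_face_perm face_perm3 t.
Qed.

(* If the two triangles at an edge had the same apex, they would glue along all
   three sides, leaving only two faces. *)
Lemma apex_neq d : 3 < #|P| -> head (phi d) != head (phi (dart_rev d)).
Proof.
move=> P3; apply/eqP => e.
have rev_phi d1 d2 : d2 = dart_rev d1 -> head (phi d1) = head (phi d2) ->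
    phi (phi d2) = dart_rev (phi d1).
  move=> -> e12; apply: dart_eq; first by rewrite tail_face_perm tail_rev.
  by rewrite head_rev -tail_face_perm face_perm3 tail_rev tail_face_perm.
pose X := porbit phi d :|: porbit phi (dart_rev d).
have XT : X = setT.
  apply: face_closed_rev_closed.
  - move=> d'; rewrite /X !inE; congr (_ || _);
      rewrite -!eq_porbit_mem; congr (_ == _); apply/eqP; rewrite eq_porbit_mem;
      exact: (mem_porbit phi 1).
  - have e1 := rev_phi _ _ erefl e.
    have e2 := rev_phi _ _ (esym (dart_revK d)) (esym e).
    have sub d' : d' \in X -> dart_rev d' \in X.
      case/setUP => /porbit_face[] ->; rewrite inE; apply/orP.
      + by right; apply: porbit_id.
      + by right; apply/porbit_face; constructor 3; rewrite e1.
      + by right; apply/porbit_face; constructor 2; rewrite e2 dart_revK.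
      + by left; rewrite dart_revK porbit_id.
      + by left; apply/porbit_face; constructor 3; rewrite e2.
      + by left; apply/porbit_face; constructor 2; rewrite e1 dart_revK.
    by move=> d'; apply/idP/idP => /sub; rewrite ?dart_revK.
  - by apply/set0Pn; exists d; rewrite inE porbit_id.
(* Two faces carry at most 6 darts, so there are at most 2 faces and, by [card_faces], at most 3
   vertices. *)
have := card_faces; have e3 : #|X| = 3 * #|faces P| by rewrite XT cardsT card_darts_faces.
have [+ _] := leq_card_setU (porbit phi d) (porbit phi (dart_rev d)).
by rewrite -/X !card_face e3; lia.
Qed.

End Triangulations.

(** * A large matching in a large edge set *)

Lemma disjoint_dart_edge (G : sgraph) (d : dart G) (B : {set G}) :
  [disjoint dart_edge d & B] = (tail d \notin B) && (head d \notin B).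
Proof. by rewrite disjoints_subset subUset !sub1set !inE. Qed.

Section Matchings.
Variable P : plane_graph.
Hypothesis tri : triangulation P.

Lemma exists_matching k (E : {set {set P}}) : 5 <= k -> 3 < #|P| ->
  E \subset edges P -> 2 * #|P| + 6 * k - 16 <= #|E| ->
  exists M : {set {set P}}, [/\ M \subset E, trivIset M & k <= #|M|].
Proof.
move=> k5 P4 sE leE; pose ok (M : {set {set P}}) := (M \subset E) && trivIset M.
have ok0 : ok set0 by rewrite /ok sub0set; apply/trivIsetP => A; rewrite inE.
case: (@arg_maxnP _ set0 ok (fun M => #|M|) ok0) => M /andP[ME trM] maxM.
exists M; split=> //; rewrite leqNgt; apply/negP => Mk.
have M2 e : e \in M -> #|e| = 2.
  by move=> /(subsetP ME) /(subsetP sE); apply: card_edge.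
have no0 (S : {set {set P}}) : S \subset edges P -> set0 \notin S.
  by move=> sS; apply/negP => /(subsetP sS) /card_edge; rewrite cards0.
pose U := cover M.
have cU : #|U| = 2 * #|M|.
  move/eqnP: trM => <-; rewrite mulnC -sum_nat_const; exact: eq_bigr.
have disjU e e' : e \in M -> [disjoint e' & U] -> [disjoint e' & e].
  move=> eM; apply: disjointWr; exact: bigcup_sup eM.
have hits d : dart_edge d \in E -> (tail d \in U) || (head d \in U).
  move=> dE; apply: contraT; rewrite negb_or => /andP[td hd].
  have dU : [disjoint dart_edge d & U].
    by rewrite disjoint_dart_edge td.
  have [|tr' nM] := trivIsetU1 _ trM (no0 _ (subset_trans ME sE)) (A := dart_edge d).
    by move=> e eM; apply: disjU.
  have := maxM (dart_edge d |: M); rewrite /ok tr' subUset sub1set dE ME => /(_ isT).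
  by rewrite cardsU1 nM add1n /= ltnn.
pose D := [set d in descending U | dart_edge d \in E].
have DU : D \subset descending U by apply/subsetP => d /setIdP[].
have cE : #|E| <= #|edges_in U| + #|D|.
  have sub : E \subset edges_in U :|: (@dart_edge P) @: D.
    apply/subsetP => e eE; have /edgesP[d ed] := subsetP sE _ eE.
    rewrite inE ed mem_edges_in; rewrite ed in eE; have := hits _ eE.
    case: (boolP (tail d \in U)) (boolP (head d \in U)) => [td|td] [hd|hd] //= _.
      by apply: imset_f; rewrite !inE td hd.
    rewrite -dart_edge_rev; apply: imset_f.
    by rewrite inE dart_edge_rev eE andbT inE tail_rev head_rev td hd.
  apply: leq_trans (subset_leq_card sub) _.
  have [+ _] := leq_card_setU (edges_in U) ((@dart_edge P) @: D).
  by move=> /leq_trans; apply; rewrite leq_add2l leq_imset_card.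
have cD := leq_trans (subset_leq_card DU) (card_descending_le tri U).
have cF := card_faces tri.
(* Too small for the planar bound: here [U] spans at most one edge, so [E] has at most
   [2 * #|P| - 3] edges. *)
have [U2|U3] := leqP #|U| 2.
  suff : #|edges_in U| <= 1 by lia.
  rewrite -(cards1 U); apply: subset_leq_card; apply/subsetP => e /setIdP[eP eU].
  by rewrite inE eqEcard eU (card_edge eP) U2.
have eU := card_edges_in_le U3.
(* The upper bounds [6k - 12] and [2 * #|P| - 4] add up to the assumed size of [E], so both are
   attained. *)
have eD : D = descending U.
  by apply/eqP; rewrite eqEcard DU; move: (card_descending_le tri U); lia.
have full : #|faces P| <= #|descending U| by rewrite -eD; lia.
have [m mM] : exists m, m \in M by apply/set0Pn; rewrite -card_gt0; lia.
have /edgesP[d md] := subsetP sE _ (subsetP ME _ mM).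
have /subsetP mU : m \subset U by apply: bigcup_sup.
have td : tail d \in m by rewrite md set21.
have hd : head d \in m by rewrite md set22.
have desc d' : dart_edge d' = m -> face_perm (rotation P) d' \in D.
  by move=> e; rewrite eD; apply: apex_descending => //; apply: mU; rewrite -e (set21, set22).
have := apex_neq tri d P4; have := desc _ (esym md); have := desc (dart_rev d).
rewrite dart_edge_rev -md => /(_ erefl).
have := tail_face_perm d; have := tail_face_perm (dart_rev d).
(* [a] and [a'] start at the two ends of [m] and lead to the apexes of the triangles on its two
   sides; they will replace [m]. *)
move: (face_perm _ _) (face_perm _ _) => a a'; rewrite head_rev => ta' ta.
move=> /setIdP[/descendingP[_ ha'] a'E] /setIdP[/descendingP[_ ha] aE] haa'.
have outer d' e : e \in M :\ m -> tail d' \in m -> head d' \notin U ->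
    [disjoint dart_edge d' & e].
  case/setD1P => em eM tm hU; rewrite disjoint_dart_edge; apply/andP; split.
    have := trivIsetP trM _ _ eM mM em.
    by rewrite disjoint_sym => /disjointFr ->.
  by apply: contraNN hU; apply/subsetP; apply: bigcup_sup.
have trM1 : trivIset (M :\ m) by apply: trivIsetS trM; apply: subD1set.
have M1E : M :\ m \subset E by apply: subset_trans (subD1set _ _) ME.
have [|trM2 nM2] := trivIsetU1 _ trM1 (no0 _ (subset_trans M1E sE)) (A := dart_edge a').
   by move=> e eM; apply: outer; rewrite ?ta'.
have M2E : dart_edge a' |: (M :\ m) \subset E by rewrite subUset sub1set a'E.
have [|trM3 nM3] := trivIsetU1 _ trM2 (no0 _ (subset_trans M2E sE)) (A := dart_edge a).
  move=> e /setU1P[->|eM]; last by apply: outer; rewrite ?ta.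
  have tU := mU _ td; have hU := mU _ hd.
  rewrite disjoint_dart_edge !inE !negb_or ta ta' haa' eq_sym (adj_neq (dart_adj d)) /= andbT.
  by apply/andP; split; [apply: contraNneq ha' => <-|apply: contraNneq ha => ->].
have := maxM (dart_edge a |: (dart_edge a' |: (M :\ m))).
rewrite /ok trM3 subUset sub1set aE M2E => /(_ isT).
by rewrite /= !cardsU1 nM3 nM2 (cardsD1 m M) mM /= !add1n ltnn.
Qed.

End Matchings.

(** * From colour representatives to a rainbow matching *)

Lemma exists_transversal (T C : finType) (c : T -> C) (A : {set T}) :
  exists B : {set T}, [/\ B \subset A, {in B &, injective c} & #|B| = #|c @: A|].
Proof.
(* [r e] depends only on the colour of [e], so its fixed points form a system of representatives. *)
pose r e := [pick e' in A | c e' == c e].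
have rP e : e \in A -> exists2 e', r e = Some e' & e' \in A /\ c e' = c e.
  rewrite /r; case: pickP => [e' /andP[e'A /eqP ce'] _|/(_ e)]; first by exists e'.
  by move=> + eA; rewrite eA eqxx.
have r_eq e e' : c e = c e' -> r e = r e'.
  by move=> ee'; apply: eq_pick => x; rewrite /= ee'.
pose B := [set e in A | r e == Some e].
have B_inj : {in B &, injective c}.
  by move=> e e' /setIdP[_ /eqP re] /setIdP[_ /eqP re'] /r_eq; rewrite re re' => -[].
have BA : B \subset A by apply/subsetP => e /setIdP[].
exists B; split=> //; rewrite -(card_in_imset B_inj).
apply: eq_card => x; apply/imsetP/imsetP => -[e eA ->].
  by exists e; rewrite ?(subsetP BA).
have [e' re' [e'A ce']] := rP _ eA; exists e' => //.
by rewrite inE e'A (r_eq _ _ ce') re' eqxx.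
Qed.

Lemma matching_edge k (e : {set matching k}) : e \in edges (matching k) ->
  exists i, e = [set (i, false); (i, true)].
Proof.
case/imsetP => -[[i b] [j b']]; rewrite inE /= => /andP[/= /eqP <- bb'] ->.
by exists i; move: bb'; case: b; case: b' => //= _; rewrite setUC.
Qed.

Lemma has_rainbow_matching k (G : sgraph) (C : finType) (c : {set G} -> C)
    (M : {set {set G}}) :
  M \subset edges G -> trivIset M -> {in M &, injective c} -> k <= #|M| ->
  has_rainbow_copy (matching k) c.
Proof.
move=> sM trM c_inj kM.
have /fin_all_exists[d dM] : forall i : 'I_k, exists d : dart G,
    dart_edge d = enum_val (widen_ord kM i).
  move=> i; have /(subsetP sM) /edgesP[d ->] := enum_valP (widen_ord kM i); by exists d.
have d_M i : dart_edge (d i) \in M by rewrite dM enum_valP.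
have d_inj i j : dart_edge (d i) = dart_edge (d j) -> i = j.
  by rewrite !dM => /enum_val_inj /(congr1 val) /= e; apply: val_inj.
(* The [i]-th edge of the matching goes to the [i]-th edge of [M] in its enumeration, oriented by
   the chosen dart. *)
pose f (u : matching k) := if u.2 then head (d u.1) else tail (d u.1).
have f_edge u : f u \in dart_edge (d u.1).
  by rewrite /f; case: ifP => _; rewrite (set21, set22).
have nd i := adj_neq (dart_adj (d i)).
exists f; split; first split.
- move=> u v fuv; have uv : u.1 = v.1.
    apply: d_inj; apply/eqP; apply: contraT => ne.
    have /disjointFr/(_ (f_edge u)) := trivIsetP trM _ _ (d_M _) (d_M _) ne.
    by rewrite fuv f_edge.
  move: u v uv fuv => [i b] [j b'] /= <-; rewrite /f /=.
  by case: b; case: b' => // e; have := nd i; rewrite e eqxx.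
- move=> [i b] [j b'] /andP[/= /eqP <-]; rewrite /f /=.
  by case: b; case: b' => //= _; [rewrite adj_sym|]; apply: dart_adj.
- have fE i : f @: [set (i, false); (i, true)] = dart_edge (d i).
    by rewrite imsetU1 imset_set1.
  move=> _ _ /matching_edge[i ->] /matching_edge[j ->].
  by rewrite !fE => /(c_inj _ _ (d_M i) (d_M j)) /d_inj ->.
Qed.

Theorem theorem1p2 (k n : nat) (hk : 5 <= k) (hn : 2 * k <= n) :
  rb n (matching k) <= 2 * n + 6 * k - 16.
Proof.
rewrite /rb; case: ex_minnP => m _; apply; apply/asboolP => P tri Pn _ C c le_c.
(* [E] has one edge of each colour, so every matching inside it is rainbow. *)
have [E [sE c_inj cE]] := exists_transversal c (edges P).
have [||M [ME trM kM]] := exists_matching tri hk _ sE; first by lia.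
  by rewrite Pn cE.
apply: has_rainbow_matching trM _ kM; first exact: subset_trans ME sE.
by move=> e e' /(subsetP ME) eE /(subsetP ME) e'E; apply: c_inj.
Qed.
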